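(* Let $F$ be a (possibly infinite, possibly uncountable) graph, and let $G$ and $H$ be finite graphs. If $F \to (G,H)$, then there is a finite subgraph $\hat{F} \subseteq F$ such that $\hat{F} \to (G,H)$.
   Context: All graphs are simple and have no isolated vertices. A subgraph $H$ of $G$ ($H\subseteq G$) is a graph with $V(H)\subseteq V(G)$ and $E(H)\subseteq E(G)$. For graphs $F,G,H$, we write $F \to (G,H)$ (''$F$ arrows $(G,H)$'') if for every coloring of the edges of $F$ with the two colors red and blue, $F$ contains a subgraph isomorphic to $G$ all of whose edges are red, or a subgraph isomorphic to $H$ all of whose edges are blue. *)

(* Defs.v *)
From mathcomp Require Import all_boot.
From mathcomp Require Import boolp classical_sets functions cardinality.

Set Implicit Arguments.
Unset Strict Implicit.
Unset Printing Implicit Defensive.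

Local Open Scope classical_set_scope.

(* The vertices are a subset of an ambient type, not the whole type, so that
   inclusion of subgraphs is literal inclusion of vertex and edge sets. *)
Record sgraph (T : Type) := SGraph {
  vertices : set T;
  edges : set (set T);
  edge_endpoints : forall e, edges e ->
    exists x y, [/\ vertices x, vertices y, x <> y & e = [set x; y]];
  no_isolated_vertex : forall x, vertices x -> exists2 e, edges e & e x
}.

Definition finite_graph T (G : sgraph T) : Prop := finite_set (vertices G).

Definition subgraph T (H G : sgraph T) : Prop :=
  vertices H `<=` vertices G /\ edges H `<=` edges G.

(* [f] is a map between the subtypes of vertices rather than between the
   ambient types: the ambient type of [H] may be empty while that of [G]
   is not, and their empty graphs are still isomorphic. *)
Definition isomorphic T U (G : sgraph T) (H : sgraph U) : Prop :=
  exists f : vertices G -> vertices H, bijective f /\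
    forall x y : vertices G,
      edges G [set \val x; \val y] <-> edges H [set \val (f x); \val (f y)].

Variant color := red | blue.

Definition mono_copy T U (F : sgraph T) (c : set T -> color) (k : color)
    (G : sgraph U) : Prop :=
  exists G' : sgraph T,
    [/\ subgraph G' F, isomorphic G' G & forall e, edges G' e -> c e = k].

(* A coloring is given by a total function on sets of vertices, of which only
   the values on [edges F] matter; every coloring of [edges F] extends to such
   a function. *)
Definition arrows T U W (F : sgraph T) (G : sgraph U) (H : sgraph W) : Prop :=
  forall c : set T -> color, mono_copy F c red G \/ mono_copy F c blue H.

(* Main.v *)
(* Compactness. If no finite subgraph of F arrows, every finite set A of edges
   spans a subgraph of F with a bad coloring c_A. The sets {A | B `<=` A}, for
   B a finite set of edges, generate a proper filter, which an ultrafilter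
   refines. The limit of the c_A along it colors F, and on any finite set B of
   edges it agrees with c_A for some A containing B. So a monochromatic copy
   for the limit coloring is also one for some c_A inside the graph spanned by
   A. *)
Require Import Defs.
From mathcomp Require Import all_boot.
From mathcomp Require Import boolp classical_sets functions cardinality.
From mathcomp Require Import filter.

Set Implicit Arguments.
Unset Strict Implicit.
Unset Printing Implicit Defensive.

Local Open Scope classical_set_scope.

Lemma filter_bigcap_finite (X I : Type) (D : set I) (f : I -> set X)
    (Phi : set_system X) :
  Filter Phi -> finite_set D -> (forall i, D i -> Phi (f i)) ->
  Phi (\bigcap_(i in D) f i).
Proof.
(* [filter_bigI] wants indices in a [choiceType]; [Pchoice] puts such a structure on any type. *)
elim/Pchoice: I => I in D f *.
by move=> FPhi /finite_fsetP[E ->] Phif; exact: filter_bigI.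
Qed.

Lemma finite_superset_ultrafilter (E : Type) :
  exists2 Phi : set_system (set E), UltraFilter Phi &
    forall B, finite_set B -> Phi [set A | finite_set A /\ B `<=` A].
Proof.
(* Finiteness of [A] is built into the filter, so that the [A] extracted later spans a finite graph.
   Each [up B] is inhabited by [B] itself. *)
pose up (B : set E) := [set A | finite_set A /\ B `<=` A].
have Fup : Filter (filter_from finite_set up).
  apply: filter_from_filter; first by exists set0.
  move=> A B finA finB; exists (A `|` B); first by rewrite finite_setU.
  by move=> C [finC]; rewrite subUset => -[sAC sBC].
have Pup : ProperFilter (filter_from finite_set up).
  by apply: filter_from_proper => A finA; exists A; split.
have [Phi [uPhi sPhi]] := ultraFilterLemma Pup.
by exists Phi => // B finB; apply: sPhi; exists B.
Qed.

(** An ultrafilter contains one of the two color classes at each [e], and [d e] is that color.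
    Finitely many such classes still meet inside the filter. *)
Lemma limit_coloring (E : Type) (c : set E -> E -> color) :
  exists d : E -> color, forall B, finite_set B ->
    exists A, [/\ finite_set A, B `<=` A & forall e, B e -> c A e = d e].
Proof.
have [Phi uPhi supPhi] := finite_superset_ultrafilter E.
have /choice[d dP] e : exists k, Phi [set A | c A e = k].
  have [rP|bP] := in_ultra_setVsetC [set A | c A e = red] uPhi.
    by exists red.
  by exists blue; apply: filterS bP => A /=; case: (c A e).
exists d => B finB.
have cdP := filter_bigcap_finite (@ultra_proper _ _ uPhi) finB (fun e _ => dP e).
have [A [[finA sBA] cdA]] := filter_ex (filterI (supPhi B finB) cdP).
by exists A.
Qed.

(** Every vertex of [G] lies on an edge, whose endpoints are vertices of [F]. *)
Lemma subgraph_edges (T : Type) (F G : sgraph T) :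
  edges G `<=` edges F -> subgraph G F.
Proof.
move=> sGF; split=> // x Gx; have [e Ge] := no_isolated_vertex Gx.
by have [y [z [Fy Fz _ ->]]] := edge_endpoints (sGF _ Ge); move=> [->|->].
Qed.

Lemma finite_edges (T : Type) (G : sgraph T) :
  finite_graph G -> finite_set (edges G).
Proof.
move=> finG; apply: (@sub_finite_set _ _
  [set [set x; y] | x in vertices G & y in vertices G]).
  move=> e Ge; have [x [y [Gx Gy _ ->]]] := edge_endpoints Ge.
  by exists x => //; exists y.
exact: finite_image2.
Qed.

Lemma isomorphic_finite (T U : Type) (G : sgraph T) (H : sgraph U) :
  isomorphic G H -> finite_graph H -> finite_graph G.
Proof.
move=> [f [[g fK gK] _]] finH.
have finHT : finite_set [set: vertices H].
  by rewrite (eq_finite_set (card_setT _)).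
apply: sub_finite_set (finite_image (fun y => \val (g y)) finHT).
move=> x Gx; pose x' : vertices G := SigSub (mem_set Gx).
by exists (f x') => //; rewrite fK.
Qed.

(** Taking the union of the kept edges as vertex set rules out isolated vertices. [A] may contain
    sets that are not edges of [F]. *)
Lemma spanned_subgraph (T : Type) (F : sgraph T) (A : set (set T)) :
  finite_set A -> exists S : sgraph T,
    [/\ subgraph S F, finite_graph S & edges S = A `&` edges F].
Proof.
move=> finA; pose B := A `&` edges F.
have endB e : B e -> exists x y,
    [/\ (\bigcup_(d in B) d) x, (\bigcup_(d in B) d) y, x <> y & e = [set x; y]].
  move=> Be; have [x [y [_ _ xy eE]]] := edge_endpoints Be.2.
  by exists x, y; split=> //; exists e => //; rewrite eE; [left|right].
have isoB x : (\bigcup_(e in B) e) x -> exists2 e, B e & e x by [].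
exists (SGraph endB isoB); split=> //.
  by apply: subgraph_edges => e [].
apply: bigcup_finite => [|e Be]; first exact: finite_setIl.
have [x [y [_ _ _ ->]]] := edge_endpoints Be.2.
by rewrite finite_setU; split; exact: finite_set1.
Qed.

Theorem theorem5 (T U W : Type) (F : sgraph T) (G : sgraph U) (H : sgraph W)
    (finG : finite_graph G) (finH : finite_graph H) :
  arrows F G H ->
  exists F' : sgraph T,
    [/\ subgraph F' F, finite_graph F' & arrows F' G H].
Proof.
move=> FGH; apply: contrapT => noF'.
have /choice[c badc] (A : set (set T)) : exists c : set T -> color,
    finite_set A -> exists2 S : sgraph T, edges S = A `&` edges F &
    ~ (mono_copy S c red G \/ mono_copy S c blue H).
  (* [choice] needs a coloring for every [A]; for infinite [A] constant red is a dummy. *)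
  have [finA|nA] := pselect (finite_set A); last by exists (fun=> red).
  have [S [sSF finS SE]] := spanned_subgraph F finA.
  apply: contrapT => /forallNP nc; apply: noF'; exists S; split=> // c.
  by apply: contrapT => badc; apply: (nc c) => _; exists S.
have [d dc] := limit_coloring c.
(* The copy [K'] itself is reused: its finitely many edges lie in a finite [A] where [c A] agrees
   with [d] on them. Only the edges of [S] matter, so any such [S] will do. *)
have transfer V (K : sgraph V) k : finite_graph K -> mono_copy F d k K ->
    exists2 A, finite_set A &
    forall S : sgraph T, edges S = A `&` edges F -> mono_copy S (c A) k K.
  move=> finK [K' [sK'F isoK' dK']].
  have [A [finA sK'A cd]] := dc _ (finite_edges (isomorphic_finite isoK' finK)).
  exists A => // S SE; exists K'; split=> //.
    by apply: subgraph_edges => e K'e; rewrite SE; split; [exact: sK'A|apply sK'F.2].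
  by move=> e K'e; rewrite cd // dK'.
by case: (FGH d) => /transfer[]// A finA copyA;
  have [S /copyA copyS []] := badc A finA; [left|right].
Qed.
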